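(* Let $D_q(a,c)=a^4-2ca^3-2a^2+(2c^3+2c)a-2c^4+2$. There exist real parameters $(a,c)$ with $D_q(a,c)\neq 0$ for which $T$ has a 4-cycle with symbolic sequence $1\to 3\to 4\to 1$, i.e. four distinct points $q_1\in Q_1$, $q_2\in Q_3$, $q_3\in Q_4$, $q_4\in Q_1$ with $q_2=T_1(q_1)$, $q_3=T_3(q_2)$, $q_4=T_4(q_3)$, $q_1=T_1(q_4)$. Whenever $D_q(a,c)\neq 0$ and such a cycle exists, its points are $q_i=\left(\frac{N_{xqi}}{D_q},\frac{N_{yqi}}{D_q}\right)$, $i=1,2,3,4$, with \begin{align*} N_{xq1}&=a^4+(3-3c)a^3-2c^2a^2+(2c^3-4c^2+2c-4)a+(2c^4-2),\\ N_{yq1}&=a^3+(2c-2)a^2+(-2c-4)a+(-4c^3+6c^2-2),\\ N_{xq2}&=a^4+(c+1)a^3-(2c^2+2c+2)a^2+(-4c^3+2c^2-6)a+(4c^4-4),\\ N_{yq2}&=3a^3+(2-2c)a^2-(6c^2+4c+4)a+(6c^3-2c-4),\\ N_{xq3}&=a^4+(1-c)a^3-(4c^2+2c)a^2+(8c^3-2c^2-4c+2)a+(2-2c^4),\\ N_{yq3}&=a^3-4ca^2+(6c^2+2c-6)a+(2c^2+4c-6),\\ N_{xq4}&=a^4+(1-3c)a^3+(2c^2-4)a^2+(6c^3-2c-4)a,\\ N_{yq4}&=a^3+(2-2c)a^2+(2-4c^2)a+(-2c^3-4c^2+6c). \end{align*}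
   Context: For real parameters $a,c$, $T:\mathbb{R}^2\to\mathbb{R}^2$ is $T(x,y)=(|x|+ay-1,\;x+c|y|-1)$. The closed quadrants are $Q_1=\{x\ge 0,y\ge 0\}$, $Q_2=\{x\le 0,y\ge 0\}$, $Q_3=\{x\le 0,y\le 0\}$, $Q_4=\{x\ge 0,y\le 0\}$. On $Q_1$ the map $T$ coincides with $T_1(x,y)=(x+ay-1,x+cy-1)$, on $Q_3$ with $T_3(x,y)=(-x+ay-1,x-cy-1)$, and on $Q_4$ with $T_4(x,y)=(x+ay-1,x-cy-1)$. *)

(* Defs.v *)
From Stdlib Require Import Reals Lra List.
Import ListNotations.
Open Scope R_scope.

Definition T (a c : R) (p : R * R) : R * R :=
  let (x, y) := p in (Rabs x + a * y - 1, x + c * Rabs y - 1).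

Definition T1 (a c : R) (p : R * R) : R * R :=
  let (x, y) := p in (x + a * y - 1, x + c * y - 1).
Definition T3 (a c : R) (p : R * R) : R * R :=
  let (x, y) := p in (- x + a * y - 1, x - c * y - 1).
Definition T4 (a c : R) (p : R * R) : R * R :=
  let (x, y) := p in (x + a * y - 1, x - c * y - 1).

Definition Q1 (p : R * R) : Prop := 0 <= fst p /\ 0 <= snd p.
Definition Q3 (p : R * R) : Prop := fst p <= 0 /\ snd p <= 0.
Definition Q4 (p : R * R) : Prop := 0 <= fst p /\ snd p <= 0.

Lemma T_on_Q1 (a c : R) (p : R * R) : Q1 p -> T a c p = T1 a c p.
Proof.
  destruct p as [x y]; intros [Hx Hy]; simpl in *.
  now rewrite (Rabs_pos_eq x Hx), (Rabs_pos_eq y Hy).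
Qed.

Lemma T_on_Q3 (a c : R) (p : R * R) : Q3 p -> T a c p = T3 a c p.
Proof.
  destruct p as [x y]; intros [Hx Hy]; simpl in *.
  rewrite (Rabs_left1 x Hx), (Rabs_left1 y Hy); f_equal; ring.
Qed.

Lemma T_on_Q4 (a c : R) (p : R * R) : Q4 p -> T a c p = T4 a c p.
Proof.
  destruct p as [x y]; intros [Hx Hy]; simpl in *.
  rewrite (Rabs_pos_eq x Hx), (Rabs_left1 y Hy); f_equal; ring.
Qed.

Definition four_cycle (f : R * R -> R * R) (q1 q2 q3 q4 : R * R) : Prop :=
  NoDup [q1; q2; q3; q4] /\
  f q1 = q2 /\ f q2 = q3 /\ f q3 = q4 /\ f q4 = q1.

(* The equations for the branches T1, T3, T4 follow from those for T and the
   quadrant conditions, by [T_on_Q1], [T_on_Q3] and [T_on_Q4]. *)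
Definition four_cycle_1341 (a c : R) (q1 q2 q3 q4 : R * R) : Prop :=
  four_cycle (T a c) q1 q2 q3 q4 /\
  (Q1 q1 /\ Q3 q2 /\ Q4 q3 /\ Q1 q4) /\
  (q2 = T1 a c q1 /\ q3 = T3 a c q2 /\ q4 = T4 a c q3 /\ q1 = T1 a c q4).

(* Conversely, the branch equations already make the points a cycle of T. *)
Lemma four_cycle_1341_branches (a c : R) (q1 q2 q3 q4 : R * R) :
  four_cycle_1341 a c q1 q2 q3 q4 <->
  NoDup [q1; q2; q3; q4] /\
  (Q1 q1 /\ Q3 q2 /\ Q4 q3 /\ Q1 q4) /\
  (q2 = T1 a c q1 /\ q3 = T3 a c q2 /\ q4 = T4 a c q3 /\ q1 = T1 a c q4).
Proof.
  split.
  - intros [[Hd _] [HQ HT]]; auto.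
  - intros [Hd [HQ HT]]; split; [split; [exact Hd |] | auto].
    destruct HQ as (h1 & h2 & h3 & h4), HT as (e1 & e2 & e3 & e4).
    rewrite (T_on_Q1 a c q1 h1), (T_on_Q3 a c q2 h2),
      (T_on_Q4 a c q3 h3), (T_on_Q1 a c q4 h4); auto.
Qed.

Definition Dq (a c : R) : R :=
  a^4 - 2*c*a^3 - 2*a^2 + (2*c^3 + 2*c)*a - 2*c^4 + 2.

Definition Nxq1 (a c : R) : R :=
  a^4 + (3 - 3*c)*a^3 - 2*c^2*a^2 + (2*c^3 - 4*c^2 + 2*c - 4)*a + (2*c^4 - 2).
Definition Nyq1 (a c : R) : R :=
  a^3 + (2*c - 2)*a^2 + (- 2*c - 4)*a + (- 4*c^3 + 6*c^2 - 2).
Definition Nxq2 (a c : R) : R :=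
  a^4 + (c + 1)*a^3 - (2*c^2 + 2*c + 2)*a^2 + (- 4*c^3 + 2*c^2 - 6)*a
  + (4*c^4 - 4).
Definition Nyq2 (a c : R) : R :=
  3*a^3 + (2 - 2*c)*a^2 - (6*c^2 + 4*c + 4)*a + (6*c^3 - 2*c - 4).
Definition Nxq3 (a c : R) : R :=
  a^4 + (1 - c)*a^3 - (4*c^2 + 2*c)*a^2 + (8*c^3 - 2*c^2 - 4*c + 2)*a
  + (2 - 2*c^4).
Definition Nyq3 (a c : R) : R :=
  a^3 - 4*c*a^2 + (6*c^2 + 2*c - 6)*a + (2*c^2 + 4*c - 6).
Definition Nxq4 (a c : R) : R :=
  a^4 + (1 - 3*c)*a^3 + (2*c^2 - 4)*a^2 + (6*c^3 - 2*c - 4)*a.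
Definition Nyq4 (a c : R) : R :=
  a^3 + (2 - 2*c)*a^2 + (2 - 4*c^2)*a + (- 2*c^3 - 4*c^2 + 6*c).

(* Main.v *)
Require Import Defs.
From Stdlib Require Import Reals.
From Stdlib Require Import Lra List.
Open Scope R_scope.

(** On the itinerary 1, 3, 4, 1 every branch of the map is affine, so the
    starting point of such a cycle is a fixed point of one affine map of the
    plane, the composite [p |-> T1 (T4 (T3 (T1 p)))].  The fixed-point
    equation is a 2x2 linear system ([return_equations]) whose determinant is
    exactly [Dq a c], so when [Dq a c <> 0] Cramer's rule
    ([cramer_2x2]) leaves [(Nxq1 / Dq, Nyq1 / Dq)] as the only candidate.
    The other three points are then forced, since each is the image of the
    preceding one under a known branch; the given fractions satisfy these
    recurrences identically in [a] and [c].

    The quadrant conditions enter only through the choice of branches, so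
    existence is a matter of inequalities on the candidate points.  They hold
    strictly at [a = -3/4], [c = 1/4] ([four_cycle_1341_example]). *)

(** The uniqueness half of Cramer's rule, with the determinant [d] and the two
    numerators abstracted so that they can be supplied in expanded form. *)
Lemma cramer_2x2 (m11 m12 m21 m22 b1 b2 d n1 n2 x y : R) :
  m11 * x + m12 * y = b1 -> m21 * x + m22 * y = b2 ->
  d = m11 * m22 - m12 * m21 ->
  n1 = b1 * m22 - m12 * b2 -> n2 = m11 * b2 - b1 * m21 ->
  d <> 0 -> x = n1 / d /\ y = n2 / d.
Proof.
  intros e1 e2 -> -> -> hd; subst b1 b2.
  split; field; exact hd.
Qed.

(** The coefficients are those of [id - M], where [M] is the linear part of the
    composite; the right-hand sides are its translation part. *)
Lemma return_equations (a c x y : R) :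
  (x, y) = T1 a c (T4 a c (T3 a c (T1 a c (x, y)))) ->
  (2 - a + 2*a*c - a^2 - a*c^2) * x + (a - a*c + a*c^2 - a*c^3) * y
    = 3*a*c - 4*a - 2 - a^2 - a*c^2 /\
  (1 + c + c^2 - c^3 - 2*a) * x + (1 + a - a^2 + a*c^2 - c^4) * y
    = 2*c^2 - c - c^3 - 3*a - 2.
Proof.
  intros h; injection h as hx hy; split.
  - apply Rminus_diag_uniq.
    rewrite <- (Rminus_diag_eq _ _ hx); ring.
  - apply Rminus_diag_uniq.
    rewrite <- (Rminus_diag_eq _ _ hy); ring.
Qed.

Lemma return_fixed_point (a c x y : R) :
  Dq a c <> 0 ->
  (x, y) = T1 a c (T4 a c (T3 a c (T1 a c (x, y)))) ->
  x = Nxq1 a c / Dq a c /\ y = Nyq1 a c / Dq a c.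
Proof.
  intros hd h; destruct (return_equations a c x y h) as [e1 e2].
  apply (cramer_2x2 _ _ _ _ _ _ _ _ _ _ _ e1 e2); [| | | exact hd].
  - unfold Dq; ring.
  - unfold Nxq1; ring.
  - unfold Nyq1; ring.
Qed.

Lemma T1_first_point (a c : R) : Dq a c <> 0 ->
  T1 a c (Nxq1 a c / Dq a c, Nyq1 a c / Dq a c) =
  (Nxq2 a c / Dq a c, Nyq2 a c / Dq a c).
Proof.
  unfold T1, Dq, Nxq1, Nyq1, Nxq2, Nyq2; intros hd.
  f_equal; field; exact hd.
Qed.

Lemma T3_second_point (a c : R) : Dq a c <> 0 ->
  T3 a c (Nxq2 a c / Dq a c, Nyq2 a c / Dq a c) =
  (Nxq3 a c / Dq a c, Nyq3 a c / Dq a c).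
Proof.
  unfold T3, Dq, Nxq2, Nyq2, Nxq3, Nyq3; intros hd.
  f_equal; field; exact hd.
Qed.

Lemma T4_third_point (a c : R) : Dq a c <> 0 ->
  T4 a c (Nxq3 a c / Dq a c, Nyq3 a c / Dq a c) =
  (Nxq4 a c / Dq a c, Nyq4 a c / Dq a c).
Proof.
  unfold T4, Dq, Nxq3, Nyq3, Nxq4, Nyq4; intros hd.
  f_equal; field; exact hd.
Qed.

(** A witness with small denominators at which the four candidate points lie in
    the interiors of the required quadrants; here [Dq (-3/4) (1/4) = 255/256]. *)
Lemma four_cycle_1341_example :
  four_cycle_1341 (-3/4) (1/4)
    (8/85, 36/85) (-104/85, -4/5) (14/17, -172/85) (114/85, 28/85).
Proof.
  apply four_cycle_1341_branches.
  split; [| split].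
  - (* The abscissas are already pairwise distinct. *)
    repeat constructor; simpl; intros h;
      repeat (destruct h as [h | h]; [injection h; intros; lra |]);
      exact h.
  - unfold Q1, Q3, Q4; simpl; lra.
  - unfold T1, T3, T4; repeat split; f_equal; lra.
Qed.

Theorem proposition3p15 :
  (exists a c : R, Dq a c <> 0 /\
     exists q1 q2 q3 q4 : R * R, four_cycle_1341 a c q1 q2 q3 q4) /\
  (forall a c : R, Dq a c <> 0 ->
   forall q1 q2 q3 q4 : R * R, four_cycle_1341 a c q1 q2 q3 q4 ->
     q1 = (Nxq1 a c / Dq a c, Nyq1 a c / Dq a c) /\
     q2 = (Nxq2 a c / Dq a c, Nyq2 a c / Dq a c) /\
     q3 = (Nxq3 a c / Dq a c, Nyq3 a c / Dq a c) /\
     q4 = (Nxq4 a c / Dq a c, Nyq4 a c / Dq a c)).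
Proof.
  split.
  - exists (-3/4), (1/4); split.
    + unfold Dq; lra.
    + do 4 eexists; exact four_cycle_1341_example.
  - intros a c hd [x y] q2 q3 q4 (_ & _ & e2 & e3 & e4 & e1).
    assert (h : (x, y) = T1 a c (T4 a c (T3 a c (T1 a c (x, y)))))
      by (rewrite <- e2, <- e3, <- e4; exact e1).
    destruct (return_fixed_point a c x y hd h) as [hx hy].
    rewrite hx, hy in e2.
    rewrite (T1_first_point a c hd) in e2; rewrite e2 in e3.
    rewrite (T3_second_point a c hd) in e3; rewrite e3 in e4.
    rewrite (T4_third_point a c hd) in e4.
    rewrite hx, hy; auto.
Qed.
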